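(* Let $A$ be a (possibly non-commutative) local ring with maximal ideal $m$. Suppose that $A$ is almost commutative, and that $A$ is both separated (i.e. $\bigcap_{n} m^{n}=\{0\}$) and complete in the $m$-adic topology. Then $A$ is a Henselian ring.
   Context: All rings are associative and unitary, not necessarily commutative. A ring $A$ is called local if all its non-invertible elements form a two-sided ideal, denoted $m$; then $k=A/m$ is a skew field, called the residue field, and the reduction map $A\to k$ (and the induced coefficientwise map $A[x]\to k[x]$) is denoted by a bar. $A[x]$ denotes the ring of polynomials over $A$ in which the indeterminate $x$ commutes with the elements of $A$. A local ring $A$ is called almost commutative if the associated graded ring $gr(A)=\frac{A}{m}\oplus\frac{m}{m^2}\oplus\frac{m^2}{m^3}\oplus\cdots$ of the filtration $\cdots\subset m^{n+1}\subset m^n\subset\cdots\subset m\subset A$ is commutative. (In particular $k$ is then commutative.) A local ring $A$ whose residue field $k$ is commutative is called Henselian if for every monic polynomial $f(x)=x^n+a_{n-1}x^{n-1}+\cdots+a_1x+a_0\in A[x]$ and every factorization $\overline{f(x)}=f_1(x)f_2(x)$ with $f_1,f_2\in k[x]$ relatively prime monic polynomials, there are unique monic polynomials $F_1(x),F_2(x)\in A[x]$ such that $f(x)=F_1(x)F_2(x)$ and $\overline{F_i(x)}=f_i(x)$ for $i=1,2$. *)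

(* Defs.v *)
From HB Require Import structures.
From mathcomp Require Import all_boot all_order all_algebra.
From mathcomp Require Import boolp.

Set Implicit Arguments.
Unset Strict Implicit.
Unset Printing Implicit Defensive.

Import GRing.Theory.
Local Open Scope ring_scope.
Local Open Scope quotient_scope.

Definition two_sided_ideal (R : nzRingType) (I : {pred R}) : Prop :=
  [/\ 0 \in I,
      forall x y, x \in I -> y \in I -> x + y \in I,
      forall a x, x \in I -> a * x \in I
    & forall a x, x \in I -> x * a \in I].

(* ring_quotient.v only equips quotients of commutative rings with a ring
   structure, hence the following construction of R / I. *)
Section QuotientRing.
Variables (R : nzRingType) (I : {pred R}) (idI : two_sided_ideal I).

Lemma two_sided_ideal_zmod : zmod_closed I.
Proof.
by case: idI => I0 ID Il _; split=> // x y Ix Iy; rewrite -mulN1r ID ?Il.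
Qed.

Definition ideal_zmod : zmodClosed R :=
  HB.pack (I : R -> bool) (GRing.isZmodClosed.Build R I two_sided_ideal_zmod).

Definition quot_ring := Quotient.quot ideal_zmod.

HB.instance Definition _ := GRing.Zmodule.on quot_ring.

Definition quot_proj (x : R) : quot_ring := \pi_(Quotient.quot ideal_zmod) x.

Lemma quot_projP x y : reflect (quot_proj x = quot_proj y) (x - y \in I).
Proof.
by apply: (iffP idP) => h; [apply/eqP|move/eqP: h];
  rewrite -(Quotient.idealrBE ideal_zmod).
Qed.

Lemma quot_proj_repr (u : quot_ring) : quot_proj (repr u) = u.
Proof. exact: reprK. Qed.

Lemma quot_proj_ind (P : quot_ring -> Prop) :
  (forall x, P (quot_proj x)) -> forall u, P u.
Proof. by move=> Pq u; rewrite -[u]quot_proj_repr. Qed.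

Lemma quot_proj_zmod_morphism : zmod_morphism quot_proj.
Proof. by move=> x y; rewrite /quot_proj !piE. Qed.

HB.instance Definition _ :=
  GRing.isZmodMorphism.Build R quot_ring quot_proj quot_proj_zmod_morphism.

Definition quot_mul (u v : quot_ring) : quot_ring :=
  quot_proj (repr u * repr v).

Lemma quot_projM x y : quot_mul (quot_proj x) (quot_proj y) = quot_proj (x * y).
Proof.
case: idI => _ ID Il Ir; apply/quot_projP.
set a := repr _; set b := repr _.
have Ia : a - x \in I by apply/quot_projP; rewrite quot_proj_repr.
have Ib : b - y \in I by apply/quot_projP; rewrite quot_proj_repr.
have -> : a * b - x * y = a * (b - y) + (a - x) * y.
  by rewrite mulrBr mulrBl addrA subrK.
by apply: ID; [apply: Il | apply: Ir].
Qed.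

Fact quot_mulA : associative quot_mul.
Proof.
elim/quot_proj_ind=> x; elim/quot_proj_ind=> y; elim/quot_proj_ind=> z.
by rewrite !quot_projM mulrA.
Qed.

Fact quot_mul1l : left_id (quot_proj 1) quot_mul.
Proof. by elim/quot_proj_ind=> x; rewrite quot_projM mul1r. Qed.

Fact quot_mul1r : right_id (quot_proj 1) quot_mul.
Proof. by elim/quot_proj_ind=> x; rewrite quot_projM mulr1. Qed.

Fact quot_mulDl : left_distributive quot_mul +%R.
Proof.
elim/quot_proj_ind=> x; elim/quot_proj_ind=> y; elim/quot_proj_ind=> z.
by rewrite -raddfD !quot_projM -raddfD mulrDl.
Qed.

Fact quot_mulDr : right_distributive quot_mul +%R.
Proof.
elim/quot_proj_ind=> x; elim/quot_proj_ind=> y; elim/quot_proj_ind=> z.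
by rewrite -raddfD !quot_projM -raddfD mulrDr.
Qed.

HB.instance Definition _ := GRing.Zmodule_isPzRing.Build quot_ring
  quot_mulA quot_mul1l quot_mul1r quot_mulDl quot_mulDr.

Lemma quot_proj_monoid_morphism : monoid_morphism quot_proj.
Proof. by split=> // x y; rewrite -quot_projM. Qed.

HB.instance Definition _ :=
  GRing.isMonoidMorphism.Build R quot_ring quot_proj quot_proj_monoid_morphism.

End QuotientRing.

Section IdealPower.
Variable R : nzRingType.

Definition ideal_mul (I J : {pred R}) : {pred R} :=
  [pred z | `[< exists2 s : seq (R * R),
                  all (fun p => (p.1 \in I) && (p.2 \in J)) s
                & z = \sum_(p <- s) p.1 * p.2 >]].

Fixpoint ideal_exp (I : {pred R}) (n : nat) : {pred R} :=
  if n is n'.+1 then ideal_mul I (ideal_exp I n') else predT.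

Lemma ideal_mulP (I J : {pred R}) z :
  reflect (exists2 s : seq (R * R),
             all (fun p => (p.1 \in I) && (p.2 \in J)) s
           & z = \sum_(p <- s) p.1 * p.2) (z \in ideal_mul I J).
Proof. exact: asboolP. Qed.

Lemma mem_ideal_mul (I J : {pred R}) x y :
  x \in I -> y \in J -> x * y \in ideal_mul I J.
Proof.
move=> Ix Jy; apply/ideal_mulP; exists [:: (x, y)]; first by rewrite /= Ix Jy.
by rewrite big_seq1.
Qed.

Lemma ideal_mul_ideal (I J : {pred R}) :
  two_sided_ideal I -> two_sided_ideal J -> two_sided_ideal (ideal_mul I J).
Proof.
move=> [_ _ Il _] [_ _ _ Jr]; split.
- by apply/ideal_mulP; exists [::]; rewrite ?big_nil.
- move=> x y /ideal_mulP[s Hs ->] /ideal_mulP[t Ht ->].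
  by apply/ideal_mulP; exists (s ++ t); rewrite ?big_cat // all_cat Hs.
- move=> a x /ideal_mulP[s Hs ->].
  apply/ideal_mulP; exists [seq (a * p.1, p.2) | p <- s].
    rewrite all_map; apply: sub_all Hs => p /= /andP[Ip Jp].
    by rewrite Il.
  by rewrite big_map mulr_sumr; apply: eq_bigr => p _; rewrite mulrA.
- move=> a x /ideal_mulP[s Hs ->].
  apply/ideal_mulP; exists [seq (p.1, p.2 * a) | p <- s].
    rewrite all_map; apply: sub_all Hs => p /= /andP[Ip Jp].
    by rewrite Ip Jr.
  by rewrite big_map mulr_suml; apply: eq_bigr => p _; rewrite mulrA.
Qed.

Variables (I : {pred R}) (idI : two_sided_ideal I).

Lemma ideal_exp_ideal n : two_sided_ideal (ideal_exp I n).
Proof. by elim: n => [|n IHn]; [split | apply: ideal_mul_ideal]. Qed.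

Lemma ideal_exp_sum (T : Type) (r : seq T) (P : pred T) (F : T -> R) n :
  (forall i, P i -> F i \in ideal_exp I n) ->
  \sum_(i <- r | P i) F i \in ideal_exp I n.
Proof.
move=> HF; case: (ideal_exp_ideal n) => E0 ED _ _.
exact: (big_ind (fun x => x \in ideal_exp I n)).
Qed.

Lemma ideal_expM i j x y :
  x \in ideal_exp I i -> y \in ideal_exp I j -> x * y \in ideal_exp I (i + j).
Proof.
elim: i x => [|i IHi] x; first by case: (ideal_exp_ideal j) => _ _ El _ _ /El.
move=> /ideal_mulP[s Hs ->] Hy.
rewrite mulr_suml big_seq; apply: (@ideal_exp_sum _ _ _ _ (i + j).+1) => p sp.
have /andP[Ip Ep] := allP Hs p sp.
by rewrite -mulrA; apply: mem_ideal_mul => //; apply: IHi.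
Qed.

End IdealPower.

(* The direct sum of the I^n is realized as the ring of polynomials whose n-th
   coefficient lies in I^n, the direct sum of the I^(n+1) as the ideal of those
   whose n-th coefficient lies in I^(n+1). Their quotient is the direct sum of
   the I^n / I^(n+1), with the product induced by
   (a + I^(i+1)) (b + I^(j+1)) = a b + I^(i+j+1). *)
Section AssociatedGraded.
Variables (R : nzRingType) (I : {pred R}) (idI : two_sided_ideal I).

Definition sum_powers_pred : {pred {poly R}} :=
  [pred p : {poly R} | `[< forall n, p`_n \in ideal_exp I n >]].

Lemma sum_powers_predP (p : {poly R}) :
  reflect (forall n, p`_n \in ideal_exp I n) (p \in sum_powers_pred).
Proof. exact: asboolP. Qed.

Lemma sum_powers_subring : subring_closed sum_powers_pred.
Proof.
split=> [|p q /sum_powers_predP Hp /sum_powers_predP Hq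
         |p q /sum_powers_predP Hp /sum_powers_predP Hq];
  apply/sum_powers_predP => n.
- by rewrite coef1; case: n => [|n] //=; case: (ideal_exp_ideal idI n.+1).
- case: (ideal_exp_ideal idI n) => _ ED El _.
  by rewrite coefB -mulN1r ED ?El.
- rewrite coefM; apply: ideal_exp_sum => // i _.
  by rewrite -[n in ideal_exp I n](subnKC (leq_ord i)); apply: ideal_expM.
Qed.

(* idI is a parameter of the type so that its ring structure can be inferred. *)
Record sum_powers (idI' : two_sided_ideal I) := SumPowers {
  sum_powers_val :> {poly R};
  _ : sum_powers_val \in sum_powers_pred
}.

End AssociatedGraded.

Section AssociatedGradedRing.
Variables (R : nzRingType) (I : {pred R}) (idI : two_sided_ideal I).

HB.instance Definition _ := [isSub for (@sum_powers_val R I idI)].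
HB.instance Definition _ := [Choice of sum_powers idI by <:].
HB.instance Definition _ := GRing.SubChoice_isSubNzRing.Build {poly R}
  (sum_powers_pred I) (sum_powers idI) (sum_powers_subring idI).

Definition sum_next_powers : {pred sum_powers idI} :=
  [pred p : sum_powers idI |
     `[< forall n, (p : {poly R})`_n \in ideal_exp I n.+1 >]].

Lemma sum_next_powersP (p : sum_powers idI) :
  reflect (forall n, (p : {poly R})`_n \in ideal_exp I n.+1)
          (p \in sum_next_powers).
Proof. exact: asboolP. Qed.

Lemma sum_next_powers_ideal : two_sided_ideal sum_next_powers.
Proof.
have valS (p : sum_powers idI) n : (p : {poly R})`_n \in ideal_exp I n.
  by case: p => p Hp /=; apply/sum_powers_predP.
split.
- apply/sum_next_powersP => n.
  have -> : ((0 : sum_powers idI) : {poly R}) = 0 := raddf0 val.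
  by rewrite coef0; case: (ideal_exp_ideal idI n.+1).
- move=> p q /sum_next_powersP Hp /sum_next_powersP Hq.
  apply/sum_next_powersP => n.
  have -> : ((p + q : sum_powers idI) : {poly R}) = val p + val q :=
    raddfD val p q.
  by rewrite coefD; case: (ideal_exp_ideal idI n.+1) => _ ED _ _; apply: ED.
- move=> p q /sum_next_powersP Hq; apply/sum_next_powersP => n.
  have -> : ((p * q : sum_powers idI) : {poly R}) = val p * val q :=
    rmorphM val p q.
  rewrite coefM; apply: (@ideal_exp_sum _ _ idI _ _ _ _ n.+1) => i _.
  have := ideal_expM idI (valS p i) (Hq (n - i)%N).
  by rewrite addnS subnKC ?leq_ord.
- move=> p q /sum_next_powersP Hq; apply/sum_next_powersP => n.
  have -> : ((q * p : sum_powers idI) : {poly R}) = val q * val p :=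
    rmorphM val q p.
  rewrite coefM; apply: (@ideal_exp_sum _ _ idI _ _ _ _ n.+1) => i _.
  have := ideal_expM idI (Hq i) (valS p (n - i)%N).
  by rewrite addSn subnKC ?leq_ord.
Qed.

Definition assoc_graded : pzRingType := quot_ring sum_next_powers_ideal.

End AssociatedGradedRing.

Definition max_ideal (A : unitRingType) : {pred A} :=
  [pred x | x \isn't a GRing.unit].
Arguments max_ideal A : clear implicits.

Definition local_ring (A : unitRingType) : Prop := two_sided_ideal (max_ideal A).

Definition almost_commutative (A : unitRingType) (locA : local_ring A) : Prop :=
  commutative (@GRing.mul (assoc_graded locA)).

Section Adic.
Variable A : unitRingType.

Local Notation m_exp n := (ideal_exp (max_ideal A) n).

Definition adic_separated : Prop :=
  forall x : A, (forall n, x \in m_exp n) -> x = 0.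

Definition adic_cauchy (u : nat -> A) : Prop :=
  forall n, exists N, forall i j,
    (N <= i)%N -> (N <= j)%N -> u i - u j \in m_exp n.

Definition adic_limit (u : nat -> A) (l : A) : Prop :=
  forall n, exists N, forall i, (N <= i)%N -> u i - l \in m_exp n.

(* The m-adic topology is first countable: sequences suffice. *)
Definition adic_complete : Prop :=
  forall u, adic_cauchy u -> exists l, adic_limit u l.

End Adic.

Section Residue.
Variables (A : unitRingType) (locA : local_ring A).

Definition residue := quot_ring locA.

HB.instance Definition _ := GRing.PzRing.on residue.

Fact residue_nonzero1 : (1 : residue) != 0.
Proof.
apply/eqP => e10.
have /quot_projP : quot_proj locA 1 = quot_proj locA 0.
  by rewrite rmorph1 rmorph0.
by rewrite subr0 inE unitr1.
Qed.

HB.instance Definition _ :=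
  GRing.PzSemiRing_isNonZero.Build residue residue_nonzero1.

End Residue.

(* A / m with its field structure, once it is known to be commutative. *)
Section ResidueField.
Variables (A : unitRingType) (locA : local_ring A).
Variable comk : commutative (@GRing.mul (residue locA)).

Definition residue_field
  of commutative (@GRing.mul (residue locA)) := residue locA.

Local Notation k := (residue_field comk).

HB.instance Definition _ := GRing.NzRing.on k.
HB.instance Definition _ := GRing.PzRing_hasCommutativeMul.Build k comk.

Definition reduction (x : A) : k := quot_proj locA x.

Fact reduction_zmod_morphism : zmod_morphism reduction.
Proof. exact: raddfB (quot_proj locA). Qed.

Fact reduction_monoid_morphism : monoid_morphism reduction.
Proof. exact: quot_proj_monoid_morphism. Qed.

HB.instance Definition _ :=
  GRing.isZmodMorphism.Build A k reduction reduction_zmod_morphism.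
HB.instance Definition _ :=
  GRing.isMonoidMorphism.Build A k reduction reduction_monoid_morphism.

Definition residue_inv (u : k) : k :=
  if u == 0 then 0 else reduction (repr (u : residue locA))^-1.

Fact residue_mulVf (u : k) : u != 0 -> residue_inv u * u = 1.
Proof.
move=> nzu; rewrite /residue_inv (negPf nzu).
have uE : u = reduction (repr (u : residue locA)) by rewrite /reduction quot_proj_repr.
rewrite [X in _ * X]uE -rmorphM mulVr ?rmorph1 //.
apply: contraR nzu => Nu; rewrite uE; apply/eqP.
by rewrite -[RHS](rmorph0 reduction); apply/quot_projP; rewrite subr0 inE.
Qed.

Fact residue_inv0 : residue_inv 0 = 0.
Proof. by rewrite /residue_inv eqxx. Qed.

HB.instance Definition _ :=
  GRing.ComNzRing_isField.Build k residue_mulVf residue_inv0.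

End ResidueField.

Definition henselian (A : unitRingType) (locA : local_ring A) : Prop :=
  exists comk : commutative (@GRing.mul (residue locA)),
  forall (f : {poly A}) (f1 f2 : {poly residue_field comk}),
    f \is monic -> f1 \is monic -> f2 \is monic -> coprimep f1 f2 ->
    map_poly (reduction comk) f = f1 * f2 ->
    exists! F : {poly A} * {poly A},
      [/\ F.1 \is monic, F.2 \is monic, f = F.1 * F.2,
          map_poly (reduction comk) F.1 = f1
        & map_poly (reduction comk) F.2 = f2].

(* Main.v *)
(* As in the commutative case, an approximate factorization modulo m^(n+1) is
   corrected modulo m^(n+2). Commutativity of gr(A) makes every element of A
   commute with m^n modulo m^(n+1), so if h is the error, the corrections
   G1 = \sum_i h_i B_i and G2 = \sum_i h_i A_i satisfy F1 G2 + G1 F2 = h modulo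
   m^(n+2) as soon as F1 A_i + B_i F2 = X^i modulo m: the Bezout identities are
   needed over the residue field only, and sizes are controlled there. The limit
   is taken coefficientwise. For uniqueness, if the differences D1, D2 of two
   factorizations lie in m^n, then F1 D2 + D1 F2 lies in m^(n+1); Bezout turns
   this into D2 = W F2 modulo m^(n+1), and since F2 is monic of larger degree
   than D2, both W and D2 vanish modulo m^(n+1). *)
Require Import Defs.
From mathcomp Require Import all_boot all_order all_algebra.
From mathcomp Require Import boolp.

Set Implicit Arguments.
Unset Strict Implicit.
Unset Printing Implicit Defensive.

Import GRing.Theory.
Local Open Scope ring_scope.

Local Arguments ideal_exp : simpl never.

(** * Polynomials with coefficients in a two-sided ideal *)

Section CoefficientsInIdeal.
Variable R : nzRingType.
Implicit Types (I : {pred R}) (p q : {poly R}).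

Definition coefs_in I p : Prop := forall i, p`_i \in I.

Section Ideal.
Variables (I : {pred R}) (idI : two_sided_ideal I).

Lemma coefs_in0 : coefs_in I 0.
Proof. by move=> i; rewrite coef0; case: idI. Qed.

Lemma coefs_inD p q : coefs_in I p -> coefs_in I q -> coefs_in I (p + q).
Proof. by case: idI => _ ID _ _ Ip Iq i; rewrite coefD; apply: ID. Qed.

Lemma coefs_inN p : coefs_in I p -> coefs_in I (- p).
Proof. by case: idI => _ _ Il _ Ip i; rewrite coefN -mulN1r; apply: Il. Qed.

Lemma coefs_inB p q : coefs_in I p -> coefs_in I q -> coefs_in I (p - q).
Proof. by move=> Ip Iq; apply: coefs_inD => //; apply: coefs_inN. Qed.

Lemma coefs_in_sum (T : Type) (r : seq T) (F : T -> {poly R}) :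
  (forall t, coefs_in I (F t)) -> coefs_in I (\sum_(t <- r) F t).
Proof.
move=> IF; elim/big_ind: _ => //; first exact: coefs_in0.
exact: coefs_inD.
Qed.

Lemma coefs_inMl p q : coefs_in I q -> coefs_in I (p * q).
Proof.
case: idI => I0 ID Il _ Iq i; rewrite coefM.
by apply: (big_ind (fun x => x \in I)) => // j _; apply: Il.
Qed.

Lemma coefs_inMr p q : coefs_in I p -> coefs_in I (p * q).
Proof.
case: idI => I0 ID _ Ir Ip i; rewrite coefM.
by apply: (big_ind (fun x => x \in I)) => // j _; apply: Ir.
Qed.

Lemma coefs_in_congrM p p' q q' :
    coefs_in I (p - p') -> coefs_in I (q - q') ->
  coefs_in I (p * q - p' * q').
Proof.
move=> Ip Iq; have -> : p * q - p' * q' = (p - p') * q + p' * (q - q').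
  by rewrite mulrBl mulrBr subrKA.
by apply: coefs_inD; [apply: coefs_inMr | apply: coefs_inMl].
Qed.

Lemma coefs_in_mul_monic d p q :
    q \is monic -> size q = d.+1 ->
  (forall i, (d <= i)%N -> (p * q)`_i \in I) -> coefs_in I p.
Proof.
move=> mq sq Ipq; case: (idI) => I0 ID Il Ir.
have qd : q`_d = 1 by move/monicP: mq; rewrite lead_coefE sq.
suff Ip n i : (size p <= i + n)%N -> p`_i \in I.
  by move=> i; apply: (Ip (size p)); rewrite leq_addl.
elim: n i => [|n IHn] i; first by rewrite addn0 => /(nth_default 0) ->.
move=> le_p; have := Ipq (i + d)%N (leq_addl _ _).
rewrite coefM (bigD1 (inord i)) //= inordK ?ltnS ?leq_addr // addKn qd mulr1.
set s := \sum_(_ < _ | _) _ => Is.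
have Is' : s \in I.
  apply: (big_ind (fun x => x \in I)) => // j ne_j.
  have [lt_ji|le_ij] := ltnP j i.
    by rewrite [q`__]nth_default ?mulr0 // sq -addnBAC ?(ltnW lt_ji) //
               -[X in (X < _)%N]add0n ltn_add2r subn_gt0.
  apply: Ir; apply: IHn; apply: leq_trans le_p _.
  rewrite addnS -addSn leq_add2r ltn_neqAle le_ij andbT.
  apply: contraNneq ne_j => ij; apply/eqP/val_inj.
  by rewrite /= inordK // ltnS ij -ij leq_addr.
by rewrite -[p`_i](addrK s) -[- s]mulN1r; apply: ID => //; apply: Il.
Qed.

End Ideal.

(** * Powers of an ideal and commutation modulo the next power *)

Variables (I : {pred R}) (idI : two_sided_ideal I).

Lemma ideal_exp_le m n x :
  (m <= n)%N -> x \in ideal_exp I n -> x \in ideal_exp I m.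
Proof.
move=> /subnK <-; elim: (n - m)%N => // k IHk.
rewrite addSn => /ideal_mulP[s Hs ex]; apply: IHk.
case: (ideal_exp_ideal idI (k + m)) => _ _ El _.
rewrite ex big_seq; apply: ideal_exp_sum => // q sq.
by have /andP[_] := allP Hs q sq; apply: El.
Qed.

Lemma ideal_exp1 x : (x \in ideal_exp I 1) = (x \in I).
Proof.
apply/idP/idP => [/ideal_mulP[s Hs ->]|Ix].
  case: idI => I0 ID _ Ir; rewrite big_seq.
  apply: (big_ind (fun x => x \in I)) => // q sq.
  by have /andP[+ _] := allP Hs q sq; apply: Ir.
by rewrite -[x]mulr1; apply: mem_ideal_mul.
Qed.

Lemma coefs_in_expM i j p q :
    coefs_in (ideal_exp I i) p -> coefs_in (ideal_exp I j) q ->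
  coefs_in (ideal_exp I (i + j)) (p * q).
Proof.
move=> Ip Iq n; rewrite coefM; apply: ideal_exp_sum => // l _.
exact: ideal_expM.
Qed.

Lemma coefs_in_exp_le m n p : (m <= n)%N ->
  coefs_in (ideal_exp I n) p -> coefs_in (ideal_exp I m) p.
Proof. by move=> le_mn Ip i; apply: ideal_exp_le le_mn _. Qed.

(** Place [x] in degree 0 and [y] in degree [n] of the graded ring: their classes commute, and the
    degree [n] coefficient of the commutator is [x * y - y * x]. *)
Lemma assoc_graded_comm n x y :
    commutative (@GRing.mul (assoc_graded idI)) -> y \in ideal_exp I n ->
  x * y - y * x \in ideal_exp I n.+1.
Proof.
move=> comI Iy.
have Px : x%:P \in sum_powers_pred I.
  apply/sum_powers_predP => i; rewrite coefC; case: eqP => [->|_] //.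
  by case: (ideal_exp_ideal idI i).
have Py : y%:P * 'X^n \in sum_powers_pred I.
  apply/sum_powers_predP => i; rewrite coefCM coefXn.
  case: eqP => [->|_]; first by rewrite mulr1.
  by rewrite mulr0; case: (ideal_exp_ideal idI i).
pose p := SumPowers idI Px; pose q := SumPowers idI Py.
have := comI (quot_proj (sum_next_powers_ideal idI) p)
             (quot_proj (sum_next_powers_ideal idI) q).
rewrite -!rmorphM => /quot_projP/sum_next_powersP/(_ n).
have -> : ((p * q - q * p : sum_powers idI) : {poly R}) =
          val p * val q - val q * val p.
  by rewrite -!(rmorphM val) -(rmorphB val).
by rewrite /= coefB -mulrA !coefCM coefXnM ltnn subnn coefC coefXn eqxx mulr1.
Qed.

Lemma assoc_graded_comm_poly n p q :
    commutative (@GRing.mul (assoc_graded idI)) ->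
    coefs_in (ideal_exp I n) q ->
  coefs_in (ideal_exp I n.+1) (p * q - q * p).
Proof.
(* Indexing [q * p] in reverse pairs the same two coefficients in both sums, so the difference is a
   sum of commutators. *)
move=> comI Iq i; rewrite coefB coefM coefMr -sumrB.
by apply: ideal_exp_sum => // j _; apply: assoc_graded_comm.
Qed.

End CoefficientsInIdeal.

(** * Degrees of monic polynomials and of Bezout cofactors *)

Lemma size_sub_monic (R : nzRingType) d (p q : {poly R}) :
    p \is monic -> q \is monic -> size p = d.+1 -> size q = d.+1 ->
  (size (p - q)%R <= d)%N.
Proof.
move=> /monicP mp /monicP mq sp sq; apply/leq_sizeP => j.
rewrite leq_eqVlt coefB => /predU1P[<-|lt_dj].
  by move: mp mq; rewrite !lead_coefE sp sq /= => -> ->; rewrite subrr.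
by rewrite !nth_default ?subrr ?sp ?sq.
Qed.

Lemma monic_addl (R : nzRingType) d (p q : {poly R}) :
    p \is monic -> size p = d.+1 -> (size q <= d)%N ->
  p + q \is monic /\ size (p + q)%R = d.+1.
Proof.
move=> mp sp sq; have lt_qp : (size q < size p)%N by rewrite sp.
by rewrite monicE lead_coefDl // size_polyDl // sp; split.
Qed.

Lemma coprimep_Xn_decomp (k : fieldType) (f1 f2 : {poly k}) d1 d2 i :
    f1 \is monic -> f2 \is monic -> coprimep f1 f2 ->
    size f1 = d1.+1 -> size f2 = d2.+1 -> (i < d1 + d2)%N ->
  exists a b : {poly k},
    [/\ (size a <= d2)%N, (size b <= d1)%N & f1 * a + b * f2 = 'X^i].
Proof.
move=> m1 m2 /Bezout_eq1_coprimepP[[u v] /= uv1] s1 s2 lt_i.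
have nz2 := monic_neq0 m2.
(* Scale the Bezout relation by ['X^i], reduce the first cofactor modulo [f2] and move the quotient
   into [b]. The bound on [b] then follows from [b * f2 = 'X^i - f1 * a], as [f2] is monic. *)
pose a := ('X^i * u) %% f2; pose b := f1 * (('X^i * u) %/ f2) + 'X^i * v.
have sa : (size a <= d2)%N by rewrite -ltnS -s2 ltn_modp.
have e : f1 * a + b * f2 = 'X^i.
  rewrite /b mulrDl addrA -mulrA -mulrDr [_ %% _ + _]addrC -divp_eq.
  by rewrite mulrCA -mulrA -mulrDr [f1 * u]mulrC uv1 mulr1.
exists a, b; split=> //.
have [->|nzb] := eqVneq b 0; first by rewrite size_poly0.
have : (size (b * f2)%R <= d1 + d2)%N.
  have -> : b * f2 = 'X^i - f1 * a by rewrite -e addrC addKr.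
  rewrite (leq_trans (size_polyD _ _)) // geq_max size_polyXn lt_i size_polyN.
  rewrite (leq_trans (size_polyMleq _ _)) // s1 /=.
  by rewrite leq_add2l.
by rewrite size_Mmonic // s2 addnS /= leq_add2r.
Qed.

(** * Reduction to the residue field and lifting back *)

Section Henselian.
Variables (A : unitRingType) (locA : local_ring A).
Hypothesis comA : almost_commutative locA.

Local Notation m_exp n := (ideal_exp (max_ideal A) n).

Lemma almost_commutative_residue : commutative (@GRing.mul (residue locA)).
Proof.
elim/quot_proj_ind=> x; elim/quot_proj_ind=> y; rewrite -!rmorphM.
apply/quot_projP; rewrite -(ideal_exp1 locA).
exact: (assoc_graded_comm (n := 0) x comA).
Qed.

Let comk := almost_commutative_residue.
Local Notation k := (residue_field comk).
Local Notation red := (map_poly (reduction comk)).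

Lemma eq_reductionP (p q : {poly A}) :
  red p = red q <-> coefs_in (m_exp 1) (p - q).
Proof.
split=> [/polyP e i|Ipq].
  have := e i; rewrite !coef_map coefB (ideal_exp1 locA) => ei.
  exact/quot_projP.
apply/polyP => i; rewrite !coef_map; apply/quot_projP.
by have := Ipq i; rewrite coefB (ideal_exp1 locA).
Qed.

Lemma reduction_lift (p : {poly k}) :
  exists2 P : {poly A}, red P = p & (size P <= size p)%N.
Proof.
exists (\poly_(i < size p) repr (p`_i : residue locA)); last exact: size_poly.
apply/polyP => i; rewrite coef_map coef_poly; case: ltnP => [_|le_pi].
  exact: quot_proj_repr.
by rewrite raddf0 nth_default.
Qed.

Lemma size_reduction_monic (F : {poly A}) :
  F \is monic -> size (red F) = size F.
Proof.
by move=> /monicP mF; rewrite size_map_poly_id0 // mF rmorph1 oner_neq0.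
Qed.

Lemma reduction_lift_monic (p : {poly k}) :
  p \is monic -> exists2 P : {poly A}, red P = p & P \is monic.
Proof.
(* Only the part below the leading term is lifted, so that the leading coefficient is exactly 1 and
   not merely 1 modulo m. *)
move=> mp; have [Q rQ sQ] := reduction_lift (p - 'X^((size p).-1)).
have sp : size p = (size p).-1.+1 by rewrite prednK // size_poly_gt0 monic_neq0.
exists ('X^((size p).-1) + Q).
  by rewrite rmorphD /= map_polyXn rQ addrC subrK.
rewrite monicE lead_coefDl ?lead_coefXn // size_polyXn ltnS.
by rewrite (leq_trans sQ) // size_sub_monic ?monicXn ?size_polyXn.
Qed.

(** * Adic limits of polynomials *)

Lemma adic_separated_poly (p q : {poly A}) :
    adic_separated A -> (forall n, coefs_in (m_exp n) (p - q)) -> p = q.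
Proof.
move=> sepA Ipq; apply/subr0_eq/polyP => i.
by rewrite coef0; apply: sepA => n; apply: Ipq.
Qed.

Lemma adic_complete_poly d (p : nat -> {poly A}) :
    adic_complete A -> (forall n, (size (p n) <= d)%N) ->
    (forall n, coefs_in (m_exp n) (p n.+1 - p n)) ->
  exists2 q : {poly A},
    (size q <= d)%N & forall n, coefs_in (m_exp n) (p n - q).
Proof.
move=> compA sp Ip.
have idE j := ideal_exp_ideal locA j.
have Ipm n j : coefs_in (m_exp n) (p (n + j)%N - p n).
  elim: j => [|j IHj]; first by rewrite addn0 subrr; apply: coefs_in0.
  rewrite addnS -[p _.+1](subrK (p (n + j)%N)) -addrA; apply: coefs_inD => //.
  by apply: (coefs_in_exp_le locA) (Ip _); apply: leq_addr.
have lim i : exists l, adic_limit (fun n => (p n)`_i) l.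
  apply: compA => n; exists n => a b /subnKC <- /subnKC <-.
  rewrite -coefB -(subrKA (p n)).
  by rewrite -[p n - _]opprB; apply: coefs_inB.
have [l lP] := choice lim.
exists (\poly_(i < d) l i); first exact: size_poly.
move=> n i; rewrite coefB coef_poly; case: ltnP => [_|le_di]; last first.
  rewrite nth_default ?subrr //; first by case: (idE n).
  exact: leq_trans le_di.
(* The rank [N] depends on [i], but [p n] and [p (n + N)] already agree modulo m^n, which makes the
   rate of convergence uniform in [i]. *)
have [N NP] := lP i n; have [_ ED El _] := idE n.
rewrite -(subrKA (p (n + N)%N)`_i); apply: ED; last exact/NP/leq_addl.
by rewrite -coefB -[_ - _]opprB; apply: coefs_inN.
Qed.

(** * Existence and uniqueness of the lifted factorization *)

Section Factorization.
Variables (f1 f2 : {poly k}) (d1 d2 : nat).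
Hypotheses (m1 : f1 \is monic) (m2 : f2 \is monic) (co12 : coprimep f1 f2).
Hypotheses (s1 : size f1 = d1.+1) (s2 : size f2 = d2.+1).

Lemma lift_Xn_decomp :
  exists ab : nat -> {poly A} * {poly A}, forall i, (i < d1 + d2)%N ->
    [/\ (size (ab i).1 <= d2)%N, (size (ab i).2 <= d1)%N
      & f1 * red (ab i).1 + red (ab i).2 * f2 = 'X^i].
Proof.
suff /choice[ab abP] : forall i, exists ab : {poly A} * {poly A},
    (i < d1 + d2)%N ->
    [/\ (size ab.1 <= d2)%N, (size ab.2 <= d1)%N
      & f1 * red ab.1 + red ab.2 * f2 = 'X^i] by exists ab.
move=> i.
have [lt_i|_] := ltnP i (d1 + d2); last by exists (0, 0).
have [a [b [sa sb e]]] := coprimep_Xn_decomp m1 m2 co12 s1 s2 lt_i.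
have [[P rP sP] [Q rQ sQ]] := (reduction_lift a, reduction_lift b).
exists (P, Q) => _ /=; rewrite rP rQ; split=> //.
  exact: leq_trans sa.
exact: leq_trans sb.
Qed.

Lemma newton_step n (f F1 F2 : {poly A}) :
    red F1 = f1 -> red F2 = f2 ->
    let h := f - F1 * F2 in
    (size h <= d1 + d2)%N -> coefs_in (m_exp n.+1) h ->
  exists G1 G2 : {poly A},
    [/\ (size G1 <= d1)%N, (size G2 <= d2)%N,
        coefs_in (m_exp n.+1) G1, coefs_in (m_exp n.+1) G2
      & coefs_in (m_exp n.+2) (f - (F1 + G1) * (F2 + G2))].
Proof.
move=> r1 r2 h sh Ih; have [ab abP] := lift_Xn_decomp.
have idE j := ideal_exp_ideal locA j.
have IhC i : coefs_in (m_exp n.+1) (h`_i)%:P.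
  by move=> j; rewrite coefC; case: eqP => // _; case: (idE n.+1).
have lt_h (i : 'I_(size h)) : (i < d1 + d2)%N := leq_trans (ltn_ord i) sh.
pose G1 := \sum_(i < size h) (h`_i)%:P * (ab i).2.
pose G2 := \sum_(i < size h) (h`_i)%:P * (ab i).1.
have IG1 : coefs_in (m_exp n.+1) G1.
  by apply: coefs_in_sum => // i; apply: coefs_inMr.
have IG2 : coefs_in (m_exp n.+1) G2.
  by apply: coefs_in_sum => // i; apply: coefs_inMr.
exists G1, G2; split=> //.
- rewrite (leq_trans (size_sum _ _ _)) //; apply/bigmax_leqP => i _.
  have [_ sb _] := abP i (lt_h i); rewrite mul_polyC.
  exact: leq_trans (size_scale_leq _ _) sb.
- rewrite (leq_trans (size_sum _ _ _)) //; apply/bigmax_leqP => i _.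
  have [sa _ _] := abP i (lt_h i); rewrite mul_polyC.
  exact: leq_trans (size_scale_leq _ _) sa.
(* The quadratic term is harmless: one factor has coefficients in m, the other in m^(n+1). *)
have -> : f - (F1 + G1) * (F2 + G2) = h - (F1 * G2 + G1 * F2) - G1 * G2.
  by rewrite /h mulrDl !mulrDr !opprD !addrA.
apply: coefs_inB => //; last first.
  by apply: (@coefs_in_expM _ _ locA 1) => //; apply: coefs_in_exp_le IG1.
have {1}-> : h = \sum_(i < size h) (h`_i)%:P * 'X^i.
  by rewrite -{1}[h]coefK poly_def; apply: eq_bigr => i _; rewrite mul_polyC.
rewrite mulr_sumr mulr_suml -big_split -sumrB.
apply: coefs_in_sum => // i; have [_ _ e] := abP i (lt_h i).
(* The first term is a coefficient of [h] times a Bezout defect, which lies in m; the second is the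
   cost of moving [F1] past that coefficient, which almost commutativity puts in m^(n+2). *)
have -> : (h`_i)%:P * 'X^i
          - (F1 * ((h`_i)%:P * (ab i).1) + (h`_i)%:P * (ab i).2 * F2)
  = (h`_i)%:P * ('X^i - (F1 * (ab i).1 + (ab i).2 * F2))
    - (F1 * (h`_i)%:P - (h`_i)%:P * F1) * (ab i).1.
  rewrite mulrBr mulrDr mulrBl !mulrA opprB -addrA; congr (_ + _).
  by rewrite [in RHS]opprD addrACA addNr add0r -opprD addrC.
apply: coefs_inB => //; last first.
  by apply: coefs_inMr => //; apply: assoc_graded_comm_poly.
rewrite -addn1; apply: (@coefs_in_expM _ _ locA) => //.
by apply/eq_reductionP; rewrite map_polyXn rmorphD !rmorphM /= r1 r2 e.
Qed.

Lemma hensel_exists (f : {poly A}) :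
    adic_separated A -> adic_complete A ->
    f \is monic -> red f = f1 * f2 ->
  exists F : {poly A} * {poly A},
    [/\ F.1 \is monic, F.2 \is monic, f = F.1 * F.2, red F.1 = f1
      & red F.2 = f2].
Proof.
move=> sepA compA mf rf; have idE j := ideal_exp_ideal locA j.
have [F1 rF1 mF1] := reduction_lift_monic m1.
have [F2 rF2 mF2] := reduction_lift_monic m2.
have sF1 : size F1 = d1.+1 by rewrite -size_reduction_monic ?rF1.
have sF2 : size F2 = d2.+1 by rewrite -size_reduction_monic ?rF2.
have sf : size f = (d1 + d2).+1.
  by rewrite -size_reduction_monic // rf size_Mmonic ?monic_neq0 // s1 s2 addnS.
have red_add (F P : {poly A}) : coefs_in (m_exp 1) P -> red (F + P) = red F.
  by move=> IP; apply/eq_reductionP; rewrite addrC addKr.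
(* [G] is the total correction to the fixed lifts [F1], [F2]; its size bounds keep the corrected
   factors monic of degrees [d1] and [d2]. *)
pose inv n (G : {poly A} * {poly A}) :=
  [/\ (size G.1 <= d1)%N, (size G.2 <= d2)%N,
      coefs_in (m_exp 1) G.1, coefs_in (m_exp 1) G.2
    & coefs_in (m_exp n.+1) (f - (F1 + G.1) * (F2 + G.2))].
(* Putting the invariant under the existential makes the step total, as choice requires; [(0, 0)] is
   a dummy value where the invariant fails. *)
have /choice[step stepP] : forall nG : nat * ({poly A} * {poly A}),
    exists H : {poly A} * {poly A}, inv nG.1 nG.2 ->
    [/\ inv nG.1.+1 H, coefs_in (m_exp nG.1.+1) (H.1 - nG.2.1)
      & coefs_in (m_exp nG.1.+1) (H.2 - nG.2.2)].
  case=> n [P Q] /=.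
  have [invPQ|] := pselect (inv n (P, Q)); last by exists (0, 0).
  have [/= sP sQ IP IQ Ih] := invPQ.
  have [mFP sFP] := monic_addl mF1 sF1 sP.
  have [mFQ sFQ] := monic_addl mF2 sF2 sQ.
  have sh : (size (f - (F1 + P) * (F2 + Q))%R <= d1 + d2)%N.
    apply: size_sub_monic => //; first by rewrite monicMr.
    by rewrite size_Mmonic ?monic_neq0 // sFP sFQ addnS.
  have rP : red (F1 + P) = f1 by rewrite red_add.
  have rQ : red (F2 + Q) = f2 by rewrite red_add.
  have [G1 [G2 [sG1 sG2 IG1 IG2 IFG]]] := newton_step rP rQ sh Ih.
  have le_size d (p q : {poly A}) :
      (size p <= d)%N -> (size q <= d)%N -> (size (p + q)%R <= d)%N.
    by move=> sp sq; rewrite (leq_trans (size_polyD _ _)) // geq_max sp.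
  exists (P + G1, Q + G2) => _ /=; split; try by rewrite addrC addKr.
  split=> /=; rewrite ?addrA //; try exact: le_size.
    by apply: coefs_inD => //; apply: coefs_in_exp_le IG1.
  by apply: coefs_inD => //; apply: coefs_in_exp_le IG2.
pose G := fix G n := if n is n'.+1 then step (n', G n') else (0, 0).
have invG n : inv n (G n).
  elim: n => [|n IHn]; last by have [] := stepP (n, G n) IHn.
  split; rewrite /= ?size_poly0 //; try exact: coefs_in0.
  by apply/eq_reductionP; rewrite rf !addr0 rmorphM /= rF1 rF2.
have [|n|P sP limP] := @adic_complete_poly d1 (fun n => (G n).1) compA.
- by move=> n; have [] := invG n.
- apply: (coefs_in_exp_le locA (leqnSn n)).
  by have [] := stepP (n, G n) (invG n).
have [|n|Q sQ limQ] := @adic_complete_poly d2 (fun n => (G n).2) compA.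
- by move=> n; have [] := invG n.
- apply: (coefs_in_exp_le locA (leqnSn n)).
  by have [] := stepP (n, G n) (invG n).
have [mFP _] := monic_addl mF1 sF1 sP.
have [mFQ _] := monic_addl mF2 sF2 sQ.
(* The limits agree modulo m with the corrections of index 1, which have coefficients in m; hence
   the reductions of the factors are unchanged. *)
have [_ _ IP1 IQ1 _] := invG 1%N.
exists (F1 + P, F2 + Q); split=> //=.
- apply: adic_separated_poly => // n; have [_ _ _ _ IG] := invG n.
  rewrite -(subrKA ((F1 + (G n).1) * (F2 + (G n).2))).
  apply: coefs_inD => //; first exact: coefs_in_exp_le (leqnSn n) IG.
  by apply: coefs_in_congrM => //; rewrite opprD addrACA subrr add0r.
- by rewrite red_add // -[P](subKr (G 1%N).1); apply: coefs_inB.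
- by rewrite red_add // -[Q](subKr (G 1%N).2); apply: coefs_inB.
Qed.

Lemma hensel_unique (F1 F2 G1 G2 : {poly A}) :
    adic_separated A ->
    F1 \is monic -> F2 \is monic -> G1 \is monic -> G2 \is monic ->
    red F1 = f1 -> red F2 = f2 -> red G1 = f1 -> red G2 = f2 ->
  F1 * F2 = G1 * G2 -> F1 = G1 /\ F2 = G2.
Proof.
move=> sepA mF1 mF2 mG1 mG2 rF1 rF2 rG1 rG2 eFG.
have idE j := ideal_exp_ideal locA j.
have sF2 : size F2 = d2.+1 by rewrite -size_reduction_monic ?rF2.
have sG2 : size G2 = d2.+1 by rewrite -size_reduction_monic ?rG2.
have [[u v] /= uv1] := Bezout_eq1_coprimepP _ _ co12.
have [[U rU _] [V rV _]] := (reduction_lift u, reduction_lift v).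
have IE : coefs_in (m_exp 1) (U * F1 + V * F2 - 1).
  by apply/eq_reductionP; rewrite rmorphD !rmorphM /= rU rV rF1 rF2 uv1 rmorph1.
suff ID n : coefs_in (m_exp n.+1) (G1 - F1) /\ coefs_in (m_exp n.+1) (G2 - F2).
  by split; apply/esym/adic_separated_poly => // n;
     apply: (coefs_in_exp_le locA (leqnSn n)); have [] := ID n.
elim: n => [|n [I1 I2]]; first by split; apply/eq_reductionP; congruence.
set D1 := G1 - F1 in I1 *; set D2 := G2 - F2 in I2 *.
have IS : coefs_in (m_exp n.+2) (F1 * D2 + D1 * F2).
  (* Expand [G1 * G2] with [G1 = F1 + D1] and [G2 = F2 + D2]. *)
  have -> : F1 * D2 + D1 * F2 = - (D1 * D2).
    apply/eqP; rewrite -addr_eq0 -addrA -mulrDr [F2 + _]addrC /D2 subrK.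
    by rewrite addrC mulrBr mulrBl subrKA eFG subrr.
  apply: coefs_inN => //.
  by apply: (@coefs_in_expM _ _ locA 1) => //; apply: coefs_in_exp_le I1.
have sD2 : (size D2 <= d2)%N by apply: size_sub_monic.
clearbody D1 D2.
have IW : coefs_in (m_exp n.+2) ((V * D2 - U * D1) * F2 - D2).
  (* Each of the three terms is in m^(n+2): a Bezout defect in m times [D2], a multiple of the sum
     just bounded, and a multiple of a commutator with [D2]. *)
  have -> : (V * D2 - U * D1) * F2 - D2 =
      (U * F1 + V * F2 - 1) * D2 - U * (F1 * D2 + D1 * F2)
      - V * (F2 * D2 - D2 * F2).
    rewrite !mulrBl mulrDl mul1r mulrDr mulrBr !mulrA opprB.
    rewrite -[_ * D2 + _ - D2]addrA [- (_ + _)]opprD.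
    rewrite [_ + (- _ - _)]addrACA subrr add0r.
    rewrite [RHS]addrC -[_ - D2 + _]addrA [RHS]addrA subrK.
    by rewrite [- D2 + _]addrC addrA.
  apply: coefs_inB => //; last first.
    by apply: coefs_inMl => //; apply: assoc_graded_comm_poly.
  apply: coefs_inB => //; last exact: coefs_inMl.
  exact: (@coefs_in_expM _ _ locA 1).
have {}I2 : coefs_in (m_exp n.+2) D2.
  have IVU : coefs_in (m_exp n.+2) (V * D2 - U * D1).
    (* From index [d2] on [D2] has no coefficients, so there [IW] bounds the product with [F2]
       alone. *)
    apply: (coefs_in_mul_monic (idE _) mF2 sF2) => i le_i.
    have := IW i; rewrite coefB [D2`__]nth_default ?subr0 //.
    exact: leq_trans le_i.
  rewrite -[D2](subKr ((V * D2 - U * D1) * F2)); apply: coefs_inB => //.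
  exact: coefs_inMr.
(* With [D2] settled, [IS] puts [D1 * F2] in m^(n+2), and the monic factor [F2] cancels. *)
split=> //; apply: (coefs_in_mul_monic (idE _) mF2 sF2) => i _.
rewrite -[D1 * F2](addKr (F1 * D2)) addrC; apply: coefs_inB => //.
exact: coefs_inMl.
Qed.

End Factorization.

End Henselian.

Theorem theorem5 (A : unitRingType) (locA : local_ring A) :
  almost_commutative locA ->
  adic_separated A ->
  adic_complete A ->
  henselian locA.
Proof.
move=> comA sepA compA; exists (almost_commutative_residue comA).
move=> f f1 f2 mf m1 m2 co12 rf.
have s1 : size f1 = (size f1).-1.+1.
  by rewrite prednK // size_poly_gt0 monic_neq0.
have s2 : size f2 = (size f2).-1.+1.
  by rewrite prednK // size_poly_gt0 monic_neq0.
have [F [mF1 mF2 eF rF1 rF2]] :=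
  hensel_exists m1 m2 co12 s1 s2 sepA compA mf rf.
exists F; split=> // -[G1 G2] /= [mG1 mG2 eG rG1 rG2].
have eFG : F.1 * F.2 = G1 * G2 by rewrite -eF.
have [<- <-] :=
  hensel_unique co12 s2 sepA mF1 mF2 mG1 mG2 rF1 rF2 rG1 rG2 eFG.
by case: F {mF1 mF2 eF rF1 rF2 eFG}.
Qed.
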